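(* Let $A$ be a unital $C^*$-algebra, let $\Gamma^i$, $i=1,\ldots,5$, be pre-Hilbert $A$-modules, and let $$\Gamma^1\xrightarrow{D_1}\Gamma^2\xrightarrow{D_2}\Gamma^3\xrightarrow{D_3}\Gamma^4\xrightarrow{D_4}\Gamma^5$$ be a complex (i.e. $D_{i+1}D_i=0$) of adjointable pre-Hilbert $A$-module homomorphisms. For $i=1,\ldots,4$ put $\triangle_i=D_{i-1}D_{i-1}^*+D_i^*D_i$, where $D_0=0$. Suppose that for $i=1,\ldots,4$ there exist $g_i,p_i\in\mathrm{Hom}_A(\Gamma^i,\Gamma^i)$ such that $$1_{|\Gamma^i}=g_i\triangle_i+p_i,\qquad 1_{|\Gamma^i}=\triangle_ig_i+p_i,\qquad \triangle_ip_i=0.$$ Then for $i=1,2,3$, $$p_{i+1}D_i=0\quad\text{and}\quad D_ig_i=g_{i+1}D_i.$$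
   Context: A pre-Hilbert $A$-module is a left $A$-module $U$ with a positive definite $A$-sesquilinear map $(\cdot,\cdot)_U:U\times U\to A$ (conjugate linear in the first variable), with norm $|u|_U=\sqrt{|(u,u)_U|_A}$. $\mathrm{Hom}_A(U,V)$ denotes the continuous $A$-module homomorphisms from $U$ to $V$, called pre-Hilbert $A$-module homomorphisms. Adjoints are taken with respect to the $A$-valued products. *)

(* Defs.v *)
From HB Require Import structures.
From mathcomp Require Import all_boot all_order all_algebra.
From mathcomp Require Import complex.
From mathcomp Require Import boolp classical_sets reals topology normedtype.

Set Implicit Arguments.
Unset Strict Implicit.
Unset Printing Implicit Defensive.

Import Order.TTheory GRing.Theory Num.Theory.

Local Open Scope ring_scope.
Local Open Scope complex_scope.

(* The complex numbers are R[i] for R : realType. In R[i] the relation 0 <= z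
   says that z is real and nonnegative; norms take their values in R[i].

   The product is part of the mixin, and not inherited from a ring structure,
   because the hierarchy has no join of ring and normed module structures
   below numeric domains; the ring structure is recovered from it right after.
   The zero algebra is allowed. *)
HB.mixin Record isCStarAlgebra (R : realType) A
    of CompleteNormedModule R[i] A := {
  cstar_one : A ;
  cstar_mul : A -> A -> A ;
  star : A -> A ;
  cstar_mulA : associative cstar_mul ;
  cstar_mul1 : left_id cstar_one cstar_mul ;
  cstar_mulr1 : right_id cstar_one cstar_mul ;
  cstar_mulDl : left_distributive cstar_mul +%R ;
  cstar_mulDr : right_distributive cstar_mul +%R ;
  cstar_scalerAl : forall (c : R[i]) (a b : A),
    c *: cstar_mul a b = cstar_mul (c *: a) b ;
  cstar_scalerAr : forall (c : R[i]) (a b : A),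
    c *: cstar_mul a b = cstar_mul a (c *: b) ;
  cstar_normM : forall a b : A, `|cstar_mul a b| <= `|a| * `|b| ;
  starD : {morph star : a b / a + b} ;
  starZ : forall (c : R[i]) (a : A), star (c *: a) = c^* *: star a ;
  cstar_starM : forall a b : A, star (cstar_mul a b) = cstar_mul (star b) (star a) ;
  starK : involutive star ;
  cstar_norm : forall a : A, `|cstar_mul (star a) a| = `|a| ^+ 2
}.

#[short(type="cstarAlgType")]
HB.structure Definition CStarAlgebra (R : realType) :=
  {A of isCStarAlgebra R A & CompleteNormedModule R[i] A}.

Section Ring.
Variables (R : realType) (A : cstarAlgType R).

#[export, non_forgetful_inheritance]
HB.instance Definition _ := GRing.Zmodule_isPzRing.Build A
  (@cstar_mulA R A) (@cstar_mul1 R A) (@cstar_mulr1 R A)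
  (@cstar_mulDl R A) (@cstar_mulDr R A).

Lemma starM (a b : A) : star (a * b) = star b * star a.
Proof. exact: cstar_starM. Qed.

End Ring.

Section Positive.
Context {R : realType} {A : cstarAlgType R}.

Definition invertible (a : A) : Prop := exists b : A, b * a = 1 /\ a * b = 1.

Definition spectrum (a : A) : set R[i] :=
  [set c | ~ invertible (c *: (1 : A) - a)]%classic.

Definition cstar_positive (a : A) : Prop :=
  star a = a /\ forall c, spectrum a c -> 0 <= c.

End Positive.

(* Sesquilinearity over A, for a left action and a product which is conjugate
   linear in the first variable, reads (a u, v) = (u, v) a^* and
   (u, a v) = a (u, v); the order of the factors is forced by
   (a b) u = a (b u). Since A is unital, a complex number c acts on the module
   as c *: 1. *)
HB.mixin Record isPreHilbertModule (R : realType) (A : cstarAlgType R) U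
    of GRing.Lmodule A U := {
  ip : U -> U -> A ;
  ipDl : forall u v w : U, ip (u + v) w = ip u w + ip v w ;
  ipZl : forall (a : A) (u v : U), ip (a *: u) v = ip u v * star a ;
  ipDr : forall u v w : U, ip u (v + w) = ip u v + ip u w ;
  ipZr : forall (a : A) (u v : U), ip u (a *: v) = a * ip u v ;
  ip_ge0 : forall u : U, cstar_positive (ip u u) ;
  ip_eq0 : forall u : U, ip u u = 0 -> u = 0
}.

#[short(type="preHilbertType")]
HB.structure Definition PreHilbertModule (R : realType) (A : cstarAlgType R) :=
  {U of isPreHilbertModule R A U & GRing.Lmodule A U}.

Section PreHilbert.
Context {R : realType} {A : cstarAlgType R}.
Implicit Types U V W : preHilbertType A.

Lemma ip0r U (u : U) : ip u 0 = 0 :> A.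
Proof. by rewrite -(scale0r (0 : U)) ipZr mul0r. Qed.

(* Hermitian symmetry need not be assumed: it follows from positivity by
   polarization. *)
Lemma ip_star U (u v : U) : star (ip u v : A) = ip v u.
Proof.
have h (w : U) : star (ip w w : A) = ip w w by case: (ip_ge0 w).
have star1 : star (1 : A) = 1.
  by rewrite -[LHS]mulr1 -{2}(starK (1 : A)) -starM mulr1 starK.
have sum_star (x y : U) : star (ip x y : A) + star (ip y x) = ip x y + ip y x.
  have := h (x + y); rewrite !(ipDl, ipDr) !starD !h -!addrA.
  by move=> /addrI; rewrite !addrA => /addIr; rewrite addrC.
have [j jl [jr starj]] : exists2 j : A, forall a, j * a = 'i *: a &
    (forall a, a * j = 'i *: a) /\ star j = - j.
  exists ('i *: (1 : A)) => [a|]; first by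
    rewrite -[LHS]cstar_scalerAl cstar_mul1.
  split=> [a|]; first by rewrite -[LHS]cstar_scalerAr cstar_mulr1.
  rewrite starZ star1 -scaleNr; congr (_ *: _).
  by apply/eqP; rewrite eq_complex /= oppr0 !eqxx.
have i_neq0 : ('i : R[i]) != 0 by rewrite eq_complex /= oner_eq0 andbF.
have diff_star : star (ip v u : A) - star (ip u v) = ip u v - ip v u.
  apply: (scalerI i_neq0); rewrite !scalerBr addrC -!jl -mulrN.
  have := sum_star u (j *: v).
  by rewrite ipZl ipZr !starM starK starj !mulrN !jr !jl.
have := congr2 +%R (sum_star u v) diff_star.
rewrite [star _ + _]addrC addrACA subrr addr0 addrACA subrr addr0 -!mulr2n.
have double (a : A) : a *+ 2 = (2%:R : R[i]) *: a by rewrite scaler_nat.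
have two_neq0 : (2%:R : R[i]) != 0 by rewrite pnatr_eq0.
by rewrite !double => /(scalerI two_neq0) <-; exact: starK.
Qed.

Definition hnorm U (u : U) : R[i] := sqrtC `|ip u u : A|.

(* Continuity for the norm hnorm, written out so that no topological structure
   has to be attached to the carrier of U. *)
Definition hcontinuous U V (f : U -> V) : Prop :=
  forall (u : U) (e : R[i]), 0 < e ->
    exists2 d : R[i], 0 < d &
      forall v : U, hnorm (v - u) < d -> hnorm (f v - f u) < e.

(* Hom_A(U, V) *)
Record prehilbertHom U V := PreHilbertHom {
  hom_fun :> {linear U -> V} ;
  hom_continuous : hcontinuous hom_fun
}.

Lemma hcontinuous0 U V : hcontinuous (\0 : {linear U -> V}).
Proof.
move=> u e e0; exists 1 => // v _.
by rewrite /= subr0 /hnorm ip0r normr0 sqrtC0.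
Qed.

Definition prehilbertHom0 U V : prehilbertHom U V :=
  PreHilbertHom (@hcontinuous0 U V).

Definition is_adjoint U V (f : U -> V) (g : V -> U) : Prop :=
  forall u v, ip (f u) v = ip u (g v) :> A.

Definition adjointable U V (f : U -> V) : Prop := exists g, is_adjoint f g.

(* The adjoint of f is unique when it exists; the value for a map f which is
   not adjointable is irrelevant. *)
Definition adjoint U V (f : U -> V) : V -> U :=
  xget (fun=> 0) [set g | is_adjoint f g]%classic.

(* D D^* + E^* E *)
Definition laplacian U V W (D : prehilbertHom U V) (E : prehilbertHom V W) :
    V -> V :=
  fun v => D (adjoint D v) + adjoint E (E v).

Definition is_parametrix U (L : U -> U) (g p : prehilbertHom U U) : Prop :=
  [/\ forall u, u = g (L u) + p u,
      forall u, u = L (g u) + p u &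
      forall u, L (p u) = 0].

End PreHilbert.

(* Main.v *)
Require Import Defs.
From HB Require Import structures.
From mathcomp Require Import all_boot all_order all_algebra.
From mathcomp Require Import complex.
From mathcomp Require Import boolp classical_sets reals topology normedtype.

(** Hodge theory usually starts from the fact that a harmonic element is
    closed and coclosed, read off from [(v, L v) = (D^* v, D^* v) + (E v, E v)];
    here that would need the fact that a sum of positive elements of [A]
    vanishes only if each of them does.  In a complex, definiteness of the
    product replaces this fact.  Let [D], [E] be consecutive maps
    with [E D = 0], and [L = D D^* + E^* E].  Applying [E] kills the first
    summand, so [E (L v) = E E^* E v], and definiteness allows cancelling
    adjoints: [E E^* z = 0] forces [E^* z = 0], and [E^* E v = 0] forces
    [E v = 0].  Hence [E (L v) = 0] already implies [E v = 0]
    ([closed_of_closed_laplacian]), and a harmonic element is closed and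
    coclosed ([harmonic_closed_coclosed]).

    If [L], [g], [p] is a parametrix, split the exact element [D u] as
    [L x + w] with [x = g (D u)] and [w = p (D u)] harmonic.  Since [D u] and
    [w] are closed, so is [L x], hence [x] is closed and [L x = D D^* x].  Thus
    [w] is exact and coclosed at the same time, which makes it orthogonal to
    itself: [p D = 0] ([harmonic_part_exact]).

    Finally, consecutive Laplacians [L] and [L'] are intertwined by the map [E]
    between them: both [E L] and [L' E] equal [E E^* E].  Expanding
    [g' E = g' E (L g + p)], where [E p = 0], gives
    [g' L' E g = (1 - p') E g = E g] ([parametrix_commute]). *)

Set Implicit Arguments.
Unset Strict Implicit.
Unset Printing Implicit Defensive.

Import GRing.Theory.

Local Open Scope ring_scope.

Section Adjoint.
Context {R : realType} {A : cstarAlgType R}.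
Implicit Types U V : preHilbertType A.

Lemma ip0l U (v : U) : ip 0 v = 0 :> A.
Proof. by apply: (addrI (ip 0 v)); rewrite -ipDl !addr0. Qed.

Lemma adjointP U V (f : U -> V) : adjointable f -> is_adjoint f (adjoint f).
Proof. by case=> g fg; apply: (xgetPex (fun=> 0)); exists g. Qed.

Lemma adjointable0 U V : adjointable (prehilbertHom0 U V).
Proof. by exists (fun=> 0) => u v; rewrite ip0l ip0r. Qed.

Section Cancellation.
Context {U V : preHilbertType A} {f : prehilbertHom U V}.
Hypothesis adjf : adjointable f.

Lemma map_adjoint_eq0 v : f (adjoint f v) = 0 -> adjoint f v = 0.
Proof.
by move=> ffv; apply: (@ip_eq0 R A); rewrite -(adjointP adjf) ffv ip0l.
Qed.

Lemma adjoint_map_eq0 u : adjoint f (f u) = 0 -> f u = 0.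
Proof.
by move=> ffu; apply: (@ip_eq0 R A); rewrite (adjointP adjf) ffu ip0r.
Qed.

(** The adjoint is a chosen function, not a linear map by construction; its
    value at [0] comes from definiteness. *)
Lemma adjoint0 : adjoint f 0 = 0.
Proof. by apply: (@ip_eq0 R A); rewrite -(adjointP adjf) ip0r. Qed.

End Cancellation.
End Adjoint.

Section Harmonic.
Context {R : realType} {A : cstarAlgType R} {U V W : preHilbertType A}.
Context {D : prehilbertHom U V} {E : prehilbertHom V W}.
Hypothesis ED : forall u, E (D u) = 0.
Hypotheses (adjD : adjointable D) (adjE : adjointable E).
Local Notation L := (laplacian D E).

Lemma map_laplacian v : E (L v) = E (adjoint E (E v)).
Proof. by rewrite /laplacian linearD ED add0r. Qed.

(** Applying the map [E] isolates the summand [E^* E] of the Laplacian, from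
    which both adjoints can be cancelled. *)
Lemma closed_of_closed_laplacian v : E (L v) = 0 -> E v = 0.
Proof.
by rewrite map_laplacian => /(map_adjoint_eq0 adjE)/(adjoint_map_eq0 adjE).
Qed.

Lemma laplacian_closed v : E v = 0 -> L v = D (adjoint D v).
Proof. by rewrite /laplacian => ->; rewrite (adjoint0 adjE) addr0. Qed.

Lemma harmonic_closed_coclosed v : L v = 0 -> E v = 0 /\ adjoint D v = 0.
Proof.
move=> Lv; have Ev : E v = 0.
  by apply: closed_of_closed_laplacian; rewrite Lv linear0.
by split=> //; apply: (map_adjoint_eq0 adjD); rewrite -laplacian_closed.
Qed.

(** The harmonic part of [D u] is closed, hence so is its remainder
    [L (g (D u))], which is therefore exact.  So the harmonic part is itself
    exact; being coclosed, it vanishes. *)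
Lemma harmonic_part_exact (g p : prehilbertHom V V) :
  is_parametrix L g p -> forall u, p (D u) = 0.
Proof.
case=> _ Lgp Lp u; set x := g (D u).
have [Ep Dp] := harmonic_closed_coclosed (Lp (D u)).
have Ex : E x = 0.
  apply: closed_of_closed_laplacian.
  by have := congr1 E (Lgp (D u)); rewrite linearD ED Ep addr0 => <-.
have pE : p (D u) = D (u - adjoint D x).
  rewrite linearB -(laplacian_closed Ex); apply: (canRL (addrK _)).
  by rewrite addrC -Lgp.
by rewrite pE; apply: (adjoint_map_eq0 adjD); rewrite -pE.
Qed.

End Harmonic.

Section Commutation.
Context {R : realType} {A : cstarAlgType R} {U V W X : preHilbertType A}.
Context {D : prehilbertHom U V} {E : prehilbertHom V W} {F : prehilbertHom W X}.
Hypotheses (ED : forall u, E (D u) = 0) (FE : forall v, F (E v) = 0).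
Hypotheses (adjD : adjointable D) (adjE : adjointable E).
Hypothesis adjF : adjointable F.

Lemma laplacian_commute v : laplacian E F (E v) = E (laplacian D E v).
Proof. by rewrite (map_laplacian ED) (laplacian_closed adjF). Qed.

Lemma parametrix_commute (g p : prehilbertHom V V) (g' p' : prehilbertHom W W) :
  is_parametrix (laplacian D E) g p -> is_parametrix (laplacian E F) g' p' ->
  (forall v, p' (E v) = 0) /\ (forall v, E (g v) = g' (E v)).
Proof.
move=> [_ Lgp Lp] gp'; have p'E := harmonic_part_exact FE adjE adjF gp'.
split=> // v; have [gLp' _ _] := gp'.
have [Ep _] := harmonic_closed_coclosed ED adjD adjE (Lp v).
rewrite {2}(Lgp v) linearD Ep addr0 -laplacian_commute.
by rewrite {1}(gLp' (E (g v))) p'E addr0.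
Qed.

End Commutation.

Theorem theorem3 (R : realType) (A : cstarAlgType R)
  (G1 G2 G3 G4 G5 : preHilbertType A)
  (D1 : prehilbertHom G1 G2) (D2 : prehilbertHom G2 G3)
  (D3 : prehilbertHom G3 G4) (D4 : prehilbertHom G4 G5)
  (D21 : forall u, D2 (D1 u) = 0)
  (D32 : forall u, D3 (D2 u) = 0)
  (D43 : forall u, D4 (D3 u) = 0)
  (adjD1 : adjointable D1) (adjD2 : adjointable D2)
  (adjD3 : adjointable D3) (adjD4 : adjointable D4)
  (g1 p1 : prehilbertHom G1 G1) (g2 p2 : prehilbertHom G2 G2)
  (g3 p3 : prehilbertHom G3 G3) (g4 p4 : prehilbertHom G4 G4)
  (gp1 : is_parametrix (laplacian (prehilbertHom0 G1 G1) D1) g1 p1)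
  (gp2 : is_parametrix (laplacian D1 D2) g2 p2)
  (gp3 : is_parametrix (laplacian D2 D3) g3 p3)
  (gp4 : is_parametrix (laplacian D3 D4) g4 p4) :
  [/\ (forall u, p2 (D1 u) = 0) /\ (forall u, D1 (g1 u) = g2 (D1 u)),
      (forall u, p3 (D2 u) = 0) /\ (forall u, D2 (g2 u) = g3 (D2 u)) &
      (forall u, p4 (D3 u) = 0) /\ (forall u, D3 (g3 u) = g4 (D3 u))].
Proof.
(* The complex extends to the left by the zero map. *)
have D10 u : D1 (prehilbertHom0 G1 G1 u) = 0 by rewrite linear0.
split.
- exact: (parametrix_commute D10 D21 (adjointable0 G1 G1) adjD1 adjD2 gp1 gp2).
- exact: (parametrix_commute D21 D32 adjD1 adjD2 adjD3 gp2 gp3).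
- exact: (parametrix_commute D32 D43 adjD2 adjD3 adjD4 gp3 gp4).
Qed.
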